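(* Let there be $n$ buyers and $m$ items, where buyer $i$ is unit-demand with valuation drawn from a distribution $\mathcal{D}_i$, the buyers' valuations are mutually independent, and $\boldsymbol{\mathcal{D}}=\mathcal{D}_1\times\cdots\times\mathcal{D}_n$. Then $$\textsc{ExAnte-BuyManyRev}(\boldsymbol{\mathcal{D}})\leq O(\log m)\,\textsc{SRev}(\boldsymbol{\mathcal{D}}),$$ where the constant hidden in $O(\cdot)$ is absolute (independent of $n,m,\boldsymbol{\mathcal{D}}$).
   Context: Unit-demand buyer: a valuation $v$ assigns $v_j\ge 0$ to each item $j\in[m]$ and $v(S)=\max_{j\in S}v_j$ for a set $S$; no assumption is made on $\mathcal{D}_i$ (values for different items may be arbitrarily correlated). A lottery is a vector $\lambda\in\Delta_m=\{\lambda\in[0,1]^m:\sum_j\lambda_j\le 1\}$ (probabilities of receiving each single item), and $v(\lambda)=\sum_j v_j\lambda_j$. A single-buyer mechanism is a pricing function $p$ assigning a price $p(\lambda)\ge0$ to every lottery; a buyer of type $v$ picks a lottery $\lambda_{v,p}$ maximizing $v(\lambda)-p(\lambda)$ and pays $p(\lambda_{v,p})$. The pricing $p$ is buy-many if no buyer type can obtain higher utility by adaptively purchasing a (random) sequence of lotteries from the menu—each choice possibly depending on the realized outcomes of previous lotteries—receiving the union of allocated items and paying the sum of the prices, than by purchasing a single lottery. An item pricing is a price vector $(p_1,\dots,p_m)\in\mathbb{R}_+^m$; a buyer purchases an item $j$ maximizing $v_j-p_j$ (if nonnegative) and pays $p_j$. A random pricing is a distribution over pricings. A random pricing $p$ satisfies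 ex-ante constraint $x_i\in\mathbb{R}_{\ge0}^m$ w.r.t. $\mathcal{D}_i$ if $\mathbb{E}_{v\sim\mathcal{D}_i,p}[\lambda_{v,p}]\preceq x_i$ componentwise. $\textsc{BuyManyRev}(\mathcal{D}_i,x_i)$ is the supremum of expected revenue $\mathbb{E}[p(\lambda_{v,p})]$ over distributions over buy-many pricings satisfying $x_i$. $\textsc{ExAnte-BuyManyRev}(\boldsymbol{\mathcal{D}})=\max\{\sum_i\textsc{BuyManyRev}(\mathcal{D}_i,x_i): x_i\ge0,\ \sum_i x_{ij}\le1\ \forall j\}$. A sequential item pricing specifies an order $\sigma$ of the buyers and an item pricing $p_i$ for each buyer $i$, fixed in advance; buyers arrive in order $\sigma$ and buyer $\sigma(k)$ purchases her favorite item (by utility $v_j-p_{\sigma(k),j}$, if nonnegative) among items not yet sold. $\textsc{SRev}(\boldsymbol{\mathcal{D}})$ is the optimal expected revenue over all sequential item pricings. *)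

(* Defs.v *)
From HB Require Import structures.
From mathcomp Require Import all_boot all_order all_algebra.
From mathcomp Require Import all_classical all_reals all_analysis.

Set Implicit Arguments.
Unset Strict Implicit.
Unset Printing Implicit Defensive.

Import Order.TTheory GRing.Theory Num.Theory.
Local Open Scope classical_set_scope.
Local Open Scope ring_scope.

Section BuyMany.
Variable R : realType.

(** A valuation (buyer type) for [m] items is an [m]-tuple of reals
    (v_1,...,v_m); the measurable structure is the product Borel one. *)
Definition valuation (m : nat) := m.-tuple R.

Definition nonneg_val (m : nat) : set (valuation m) :=
  [set v | forall j : 'I_m, 0 <= tnth v j].

Definition set_value (m : nat) (v : valuation m) (S : {set 'I_m}) : R :=
  \big[Num.max/0]_(j in S) tnth v j.

Definition is_lottery (m : nat) (l : 'I_m -> R) : Prop :=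
  (forall j, 0 <= l j) /\ \sum_(j < m) l j <= 1.

Definition lot_value (m : nat) (v : valuation m) (l : 'I_m -> R) : R :=
  \sum_(j < m) tnth v j * l j.

(** a pricing assigns a price to every lottery (only values on Delta_m matter) *)
Definition pricing (m : nat) := ('I_m -> R) -> R.

Definition nonneg_pricing (m : nat) (p : pricing m) : Prop :=
  forall l, is_lottery l -> 0 <= p l.

(** adaptive purchasing strategies: finite trees; after buying lottery [l]
    the continuation depends on the realized outcome (Some j = item j
    allocated, None = nothing allocated). *)
Inductive strategy (m : nat) : Type :=
| Stop : strategy m
| Buy : ('I_m -> R) -> (option 'I_m -> strategy m) -> strategy m.

Fixpoint strategy_ok (m : nat) (s : strategy m) : Prop :=
  match s with
  | Stop => True
  | Buy l k => is_lottery l /\ forall o, strategy_ok (k o)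
  end.

Fixpoint strat_utility (m : nat) (v : valuation m) (p : pricing m)
    (s : strategy m) (S : {set 'I_m}) : R :=
  match s with
  | Stop => set_value v S
  | Buy l k =>
      - p l
      + \sum_(j < m) l j * strat_utility v p (k (Some j)) (j |: S)
      + (1 - \sum_(j < m) l j) * strat_utility v p (k None) S
  end.

(** buy-many: no (nonnegative) buyer type gets more utility from any adaptive
    sequence of purchases than sup_lambda (v(lambda) - p(lambda)). *)
Definition buy_many (m : nat) (p : pricing m) : Prop :=
  forall v : valuation m, nonneg_val v ->
  forall s : strategy m, strategy_ok s ->
  forall r : R, r < strat_utility v p s (finset.set0 : {set 'I_m}) ->
  exists l, is_lottery l /\ r < lot_value v l - p l.

Definition best_lottery (m : nat) (p : pricing m) (v : valuation m)
    (l : 'I_m -> R) : Prop :=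
  is_lottery l /\
  forall l', is_lottery l' -> lot_value v l' - p l' <= lot_value v l - p l.

(** Expected revenues of distributions over buy-many pricings satisfying the
    ex-ante constraint x w.r.t. D.  A distribution over pricings is given as a
    probability space (Theta, Q) with a pricing p th and the buyer's choice
    sel th v of a utility-maximizing lottery. *)
Definition buy_many_revs (m : nat) (D : probability (valuation m) R)
    (x : 'I_m -> R) : set (\bar R) :=
  [set r | exists (dT : measure_display) (Theta : measurableType dT)
             (Q : probability Theta R)
             (p : Theta -> pricing m) (sel : Theta -> valuation m -> ('I_m -> R)),
     [/\ forall th, nonneg_pricing (p th) /\ buy_many (p th),
         forall th v, nonneg_val v -> best_lottery (p th) v (sel th v),
         measurable_fun setT
           (fun z : Theta * valuation m => p z.1 (sel z.1 z.2)) /\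
         (forall j, measurable_fun setT
           (fun z : Theta * valuation m => sel z.1 z.2 j)),
         forall j, (\int[(Q \x D)%E]_z (sel z.1 z.2 j)%:E <= (x j)%:E)%E &
         r = (\int[(Q \x D)%E]_z (p z.1 (sel z.1 z.2))%:E)%E]].

Definition BuyManyRev (m : nat) (D : probability (valuation m) R)
    (x : 'I_m -> R) : \bar R :=
  ereal_sup (buy_many_revs D x).

Definition ExAnte_BuyManyRev (n m : nat)
    (D : 'I_n -> probability (valuation m) R) : \bar R :=
  ereal_sup [set r | exists x : 'I_n -> 'I_m -> R,
    [/\ forall i j, 0 <= x i j,
        forall j, \sum_(i < n) x i j <= 1 &
        r = (\sum_(i < n) BuyManyRev (D i) (x i))%E]].

(** Sequential item pricing.  Buyer facing available items [A] and prices
    [pr] buys an available item maximizing v_j - pr_j, provided this utility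
    is nonnegative (ties broken by a fixed rule: [pick]). *)
Definition item_choice (m : nat) (pr : 'I_m -> R) (v : valuation m)
    (A : {set 'I_m}) : option 'I_m :=
  [pick j in A | (0 <= tnth v j - pr j) &&
                 [forall k in A, tnth v k - pr k <= tnth v j - pr j]].

(** Expected revenue of the buyers in [s] (arriving in this order) given that
    the items in [A] are still unsold; buyers are independent, so the
    expectation over D_1 x ... x D_n is the iterated integral. *)
Fixpoint seq_rev (n m : nat) (D : 'I_n -> probability (valuation m) R)
    (pr : 'I_n -> 'I_m -> R) (s : seq 'I_n) (A : {set 'I_m}) : \bar R :=
  match s with
  | [::] => 0%E
  | i :: s' =>
      (\int[D i]_v
        match item_choice (pr i) v A with
        | Some j => ((pr i j)%:E + seq_rev D pr s' (A :\ j))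
        | None => seq_rev D pr s' A
        end)%E
  end.

Definition SRev (n m : nat) (D : 'I_n -> probability (valuation m) R) : \bar R :=
  ereal_sup [set r | exists (s : seq 'I_n) (pr : 'I_n -> 'I_m -> R),
    [/\ perm_eq s (enum 'I_n), forall i j, 0 <= pr i j &
        r = seq_rev D pr s [set: 'I_m]%SET]].

End BuyMany.

(* Main.v *)
(** Let a buy-many pricing [p] be given and let [q_j] be the infimum of
    [p l / l_j] over all lotteries [l].  Buying [l] until [j] is obtained shows
    that no type gains more from item [j] at price [q_j] than from her favorite
    lottery.  For item costs [c], consider the prices [c_j + q_j / 2 ^ t] with
    [t = 1, ..., T] and [2 ^ T >= 2 m].  Between two consecutive values of [t]
    the utility of a buyer drops by at most the profit of the lower prices, so
    the total profit of the [T] pricings is at least the total drop in utility.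
    Whatever the set [A] of available items, this drop is at least a sum over
    [j] in [A] of contributions that do not depend on [A], and over all items
    the contributions add up to half of the price paid under [p], minus the
    cost of the lottery.  Since [A] plays no role in the prices, the bound can
    be chained over the buyers: with the cost of an item equal to half of its
    total contribution over all buyers, one loses a further factor of two, as
    in the prophet inequality with balanced prices. *)

Require Import Defs.
From HB Require Import structures.
From mathcomp Require Import all_boot all_order all_algebra.
From mathcomp Require Import all_classical all_reals all_analysis.
From mathcomp Require Import measurable_realfun ring lra.

Set Implicit Arguments.
Unset Strict Implicit.
Unset Printing Implicit Defensive.

Import Order.TTheory GRing.Theory Num.Theory.
Import numFieldNormedType.Exports.
Local Open Scope classical_set_scope.
Local Open Scope ring_scope.

(** * Lotteries and repeated purchases of one lottery *)

Lemma sum_weighted_le (R : realType) (m : nat) (l : 'I_m -> R) (M : R)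
    (A : {set 'I_m}) (f : 'I_m -> R) :
  is_lottery l -> 0 <= M -> (forall j, j \in A -> f j <= l j * M) ->
  \sum_(j in A) f j <= M.
Proof.
move=> [l0 l1] M0 fM.
apply: (@le_trans _ _ (\sum_(j in A) l j * M)); first exact: ler_sum.
rewrite -mulr_suml -[leRHS]mul1r ler_wpM2r//.
apply: le_trans l1.
by rewrite big_mkcond/=; apply: ler_sum => j _; case: ifP.
Qed.

Lemma set_value_ge0 (R : realType) (m : nat) (v : valuation R m) (S : {set 'I_m}) :
  0 <= set_value v S.
Proof. exact: bigmax_ge_id. Qed.

Lemma le_set_value (R : realType) (m : nat) (v : valuation R m) (S : {set 'I_m})
    (j : 'I_m) : j \in S -> tnth v j <= set_value v S.
Proof. by move=> jS; apply: le_bigmax_cond. Qed.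

(** Strategies are finite trees, so insisting on item [j] is cut off after [k] attempts; the limit
    in [k] is taken later. *)
Fixpoint buy_until (R : realType) (m : nat) (j : 'I_m) (l : 'I_m -> R)
    (k : nat) : strategy R m :=
  if k is k'.+1 then
    Buy l (fun o => if o == Some j then Stop R m else buy_until j l k')
  else Stop R m.

Lemma buy_until_ok (R : realType) (m : nat) (j : 'I_m) (l : 'I_m -> R) (k : nat) :
  is_lottery l -> strategy_ok (buy_until j l k).
Proof. by move=> ll; elim: k => //= k IH; split => // o; case: ifP. Qed.

(** Item [j] is obtained with probability [1 - (1 - l j) ^+ k], and the expected number of purchases
    is this probability divided by [l j]. In the induction, outcome [j] is worth at least
    [tnth v j], and every other outcome leaves [k] attempts; [S] is arbitrary because other items
    pile up on the way. *)
Lemma le_buy_until_utility (R : realType) (m : nat) (j : 'I_m) (l : 'I_m -> R)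
    (p : pricing R m) (v : valuation R m) (k : nat) (S : {set 'I_m}) :
  is_lottery l -> 0 < l j ->
  (tnth v j - p l / l j) * (1 - (1 - l j) ^+ k)
    <= strat_utility v p (buy_until j l k) S.
Proof.
move=> [l0 l1] lj0; elim: k S => [|k IH] S /=.
  by rewrite expr0 subrr mulr0 set_value_ge0.
set b := (tnth v j - p l / l j) * (1 - (1 - l j) ^+ k) in IH.
rewrite (bigD1 j)//= eqxx/=.
apply: (@le_trans _ _ (- p l + (l j * tnth v j + (\sum_(i < m | i != j) l i) * b)
    + (1 - \sum_(i < m) l i) * b)).
  rewrite [\sum_(i < m) l i](bigD1 j)//= exprS /b.
  set s := \sum_(i < m | i != j) _.
  set P := p l; set a := l j; set V := tnth v j; set e := (1 - a) ^+ k.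
  have a0 : a != 0 by rewrite gt_eqF.
  by rewrite le_eqVlt; apply/orP; left; apply/eqP; field.
rewrite lerD//; last by rewrite ler_wpM2l// subr_ge0.
rewrite lerD2l lerD//.
  by rewrite ler_wpM2l// le_set_value// in_setU1 eqxx.
rewrite mulr_suml; apply: ler_sum => i ij.
by rewrite ler_wpM2l// ifN.
Qed.

(** * Surrogate item prices of a buy-many pricing *)

Section SurrogateItemPrice.
Variables (R : realType) (m : nat) (p : pricing R m).

Definition unit_prices (j : 'I_m) : set R :=
  [set p l / l j | l in [set l | is_lottery l /\ 0 < l j]].

Definition surrogate_price (j : 'I_m) : R := inf (unit_prices j).

Hypotheses (p0 : nonneg_pricing p) (pB : buy_many p).

Lemma unit_prices_ge0 (j : 'I_m) : lbound (unit_prices j) 0.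
Proof.
by move=> _ [l [ll lj] <-]; rewrite divr_ge0// ?(ltW lj)//; exact: p0.
Qed.

Lemma unit_prices_neq0 (j : 'I_m) : unit_prices j !=set0.
Proof.
pose e (k : 'I_m) : R := (k == j)%:R.
exists (p e / e j), e => //; split; last by rewrite /e eqxx ltr01.
split; first by move=> k; rewrite /e ler0n.
by rewrite (bigD1 j)//= /e eqxx big1 ?addr0// => k /negbTE ->.
Qed.

Lemma surrogate_price_ge0 (j : 'I_m) : 0 <= surrogate_price j.
Proof.
by apply: lb_le_inf; [exact: unit_prices_neq0|exact: unit_prices_ge0].
Qed.

Lemma surrogate_price_le (l : 'I_m -> R) (j : 'I_m) :
  is_lottery l -> l j * surrogate_price j <= p l.
Proof.
move=> ll; have [lj|lj] := ltP 0 (l j); last first.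
  have -> : l j = 0 by apply/le_anti; rewrite lj ll.1.
  by rewrite mul0r; exact: p0.
rewrite mulrC -ler_pdivlMr//; apply: ge_inf; last by exists l.
by exists 0; exact: unit_prices_ge0.
Qed.

Variables (v : valuation R m) (l : 'I_m -> R).
Hypotheses (v0 : nonneg_val v) (lb : best_lottery p v l).

(** The definition of [buy_many] compares with a supremum over lotteries; a favorite lottery attains
    it. *)
Lemma strat_utility_le_best (s : strategy R m) : strategy_ok s ->
  strat_utility v p s (finset.set0 : {set 'I_m}) <= lot_value v l - p l.
Proof.
move=> sok; rewrite leNgt; apply/negP => /(pB v0 sok)[l' [ll' H]].
by move: (lb.2 _ ll'); rewrite leNgt H.
Qed.

Lemma best_utility_ge0 : 0 <= lot_value v l - p l.
Proof.
by apply: le_trans (@strat_utility_le_best (Stop R m) I); exact: set_value_ge0.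
Qed.

(** For each lottery [l'] with [l' j > 0], the utilities of [buy_until j l' k] are bounded below by
    a sequence tending to [d], the value of [j] minus the unit price of [j] through [l']. The
    infimum over [l'] then gives the surrogate price. *)
Lemma surrogate_utility_le_best (j : 'I_m) :
  tnth v j - surrogate_price j <= lot_value v l - p l.
Proof.
rewrite lerBlDr addrC -lerBlDr.
apply: lb_le_inf; first exact: unit_prices_neq0.
move=> _ [l' [ll' l'j] <-]; rewrite lerBlDr addrC -lerBlDr.
set U := _ - p l; set d := _ - _ / _.
have lj1 : l' j <= 1.
  apply: le_trans ll'.2; rewrite (bigD1 j)//= lerDl.
  by apply: sumr_ge0 => i _; exact: ll'.1.
have e0 : GRing.exp (1 - l' j) @ \oo --> (0 : R).
  by apply: cvg_expr; rewrite ger0_norm; lra.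
have cv : (fun k => d * (1 - (1 - l' j) ^+ k)) @ \oo --> d.
  rewrite -[X in _ --> X]mulr1 -[in X in _ --> X](subr0 1).
  by apply: cvgM; [exact: cvg_cst|apply: cvgB; [exact: cvg_cst|exact: e0]].
rewrite -(cvg_lim _ cv)//.
apply: limr_le; first by apply/cvg_ex; eexists; exact: cv.
apply: nearW => k.
apply: le_trans (strat_utility_le_best (buy_until_ok j k ll')).
exact: le_buy_until_utility.
Qed.

End SurrogateItemPrice.

(** * Item choices along a geometric ladder of prices *)

Section ItemChoice.
Variables (R : realType) (m : nat).
Implicit Types (pr c q : 'I_m -> R) (v : valuation R m) (A : {set 'I_m}).

Definition choice_utility pr v A : R :=
  if item_choice pr v A is Some j then tnth v j - pr j else 0.

Definition choice_profit pr c v A : R :=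
  if item_choice pr v A is Some j then pr j - c j else 0.

Lemma item_choice_in pr v A j : item_choice pr v A = Some j -> j \in A.
Proof. by rewrite /item_choice; case: pickP => // k /andP[kA _] [<-]. Qed.

Lemma choice_utility_ge0 pr v A : 0 <= choice_utility pr v A.
Proof.
by rewrite /choice_utility /item_choice; case: pickP => // k /and3P[].
Qed.

Lemma choice_utility_ge pr v A j : j \in A ->
  tnth v j - pr j <= choice_utility pr v A.
Proof.
move=> jA; rewrite /choice_utility /item_choice; case: pickP => [k|noP].
  by move=> /and3P[_ _ /forall_inP]; exact.
rewrite leNgt; apply/negP => vj0.
(* If some available item had positive utility, a utility-maximizing one would pass the test of
   [pick]. *)
have [k kA kmax] := @Order.TotalTheory.arg_maxP _ _ _ j (fun k => k \in A)
  (fun k => tnth v k - pr k) jA.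
have := noP k; rewrite /= kA /= => /negbT; rewrite negb_and => /orP[|].
  by rewrite (le_trans (ltW vj0))//; exact: kmax.
by move=> /negP; apply; apply/forall_inP => i; exact: kmax.
Qed.

Lemma choice_utility_le pr v A (M : R) : 0 <= M ->
  (forall j, j \in A -> tnth v j - pr j <= M) -> choice_utility pr v A <= M.
Proof.
rewrite /choice_utility; case E: item_choice => [k|]// _; apply.
exact: item_choice_in E.
Qed.

Definition scaled_prices c q (t : nat) : 'I_m -> R :=
  fun j => c j + (2^-1) ^+ t * q j.

(** The item bought at level [t.+1] is still available at level [t], where it costs more by exactly
    the profit [2^-(t+1) q_k] made on it at level [t.+1]. *)
Lemma choice_utility_step c q v A (t : nat) :
  choice_utility (scaled_prices c q t.+1) v A
    - choice_utility (scaled_prices c q t) v A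
  <= choice_profit (scaled_prices c q t.+1) c v A.
Proof.
rewrite [X in X - _ <= _]/choice_utility /choice_profit.
case E: item_choice => [k|]; last by rewrite sub0r oppr_le0 choice_utility_ge0.
have := choice_utility_ge (scaled_prices c q t) v (item_choice_in E).
rewrite /scaled_prices exprS.
set e := (2^-1 : R) ^+ t; set u := choice_utility _ _ _; lra.
Qed.

Lemma choice_utility_telescope c q v A (T : nat) :
  choice_utility (scaled_prices c q T) v A
    - choice_utility (scaled_prices c q 0) v A
  <= \sum_(t < T) choice_profit (scaled_prices c q t.+1) c v A.
Proof.
elim: T => [|T IH]; first by rewrite subrr big_ord0.
rewrite big_ord_recr/=; have := choice_utility_step c q v A T; lra.
Qed.

Lemma choice_utility_scale_mono c q v A (T : nat) : (forall j, 0 <= q j) ->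
  choice_utility (scaled_prices c q 0) v A
    <= choice_utility (scaled_prices c q T) v A.
Proof.
move=> q0; apply: choice_utility_le => [|j jA]; first exact: choice_utility_ge0.
apply: le_trans (choice_utility_ge _ v jA); rewrite /scaled_prices expr0 mul1r.
rewrite lerD2l lerN2 lerD2l ler_piMl// exprn_ile1// ?invr_ge0//; lra.
Qed.

End ItemChoice.

(** * Per-item contributions to the price paid *)

Section Gain.
Variables (R : realType) (m : nat) (p : pricing R m).
Implicit Types (v : valuation R m) (l : 'I_m -> R) (b N : R) (j : 'I_m).

(* The term [b * p l] dominates [b * l j * surrogate_price p j]: for a random
   pricing it is measurable in the pricing, whereas an infimum over all
   lotteries need not be.  The cap [N] makes expectations finite. *)
Definition gain b N v l j : R :=
  Num.min N (Num.max 0 (l j * (tnth v j - (lot_value v l - p l)) - b * p l)).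

Lemma gain_ge0 b N v l j : 0 <= N -> 0 <= gain b N v l j.
Proof. by move=> N0; rewrite /gain le_min N0/= le_max lexx. Qed.

Lemma gain_le b N v l j : gain b N v l j <= N.
Proof. by rewrite /gain ge_min lexx. Qed.

Hypotheses (p0 : nonneg_pricing p) (pB : buy_many p).
Variables (v : valuation R m) (l : 'I_m -> R).
Hypotheses (v0 : nonneg_val v) (lb : best_lottery p v l).

(** One item at the cap already gives [N]. Otherwise no cap is active, and dropping the positive
    parts leaves [U - L * (U - P) - m * b * P], with [U] the value, [P] the price and [L] the total
    mass of the lottery. Since [L <= 1] and [U >= P], the first two terms give at least [P], and the
    last costs at most half of it. *)
Lemma sum_gain_ge b N : 0 <= N -> m%:R * b <= 2^-1 ->
  Num.min N (p l / 2) <= \sum_(j < m) gain b N v l j.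
Proof.
move=> N0 mb.
have [[j Nj]|small] := pselect (exists j, N <= Num.max 0
    (l j * (tnth v j - (lot_value v l - p l)) - b * p l)).
  rewrite (bigD1 j)//= {1}/gain (min_idPl Nj) ge_min; apply/orP; left.
  by rewrite lerDl sumr_ge0// => i _; exact: gain_ge0.
rewrite ge_min; apply/orP; right.
apply: (@le_trans _ _ (\sum_(j < m)
   (l j * (tnth v j - (lot_value v l - p l)) - b * p l))); last first.
  apply: ler_sum => j _; rewrite /gain.
  have [jN|jN] := leP N (Num.max 0 (l j * (tnth v j - (lot_value v l - p l)) - b * p l)).
    by exfalso; apply: small; exists j.
  by rewrite le_max lexx orbT.
rewrite sumrB.
under eq_bigr do rewrite mulrBr mulrC.
rewrite sumrB -mulr_suml sumr_const card_ord -/(lot_value v l).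
have := best_utility_ge0 pB v0 lb; have := p0 lb.1; have := lb.1.2.
set U := lot_value v l; set P := p l; set L := \sum_(j < m) l j.
move=> L1 P0 U0.
have : m%:R * b * P <= 2^-1 * P by rewrite ler_wpM2r.
have : L * (U - P) <= 1 * (U - P) by rewrite ler_wpM2r.
rewrite -(mulr_natl (b * P)) mulrA; lra.
Qed.

(* Item [j] of [A] is worth at least [v_j - c_j - 2^-T q_j] at the lowest
   prices, and no item is worth more than the utility of [l] at the highest;
   averaging over [j] with the weights [l j] loses nothing because the drop
   in utility is nonnegative. *)
Lemma gain_le_profit (c : 'I_m -> R) (N : R) (T : nat) (A : {set 'I_m}) :
  (forall j, 0 <= c j) ->
  \sum_(j in A) (gain (2^-1 ^+ T) N v l j - c j * l j) <=
  \sum_(t < T)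
     choice_profit (scaled_prices c (surrogate_price p) t.+1) c v A.
Proof.
move=> c0; set q := surrogate_price p.
have q0 j : 0 <= q j by exact: surrogate_price_ge0.
apply: le_trans (choice_utility_telescope c q v A T).
have UT := choice_utility_scale_mono c v A T q0.
apply: (sum_weighted_le lb.1) => [|j jA]; first by rewrite subr_ge0.
set M := (X in _ <= _ * X).
have M0 : 0 <= M by rewrite subr_ge0.
have l0 := lb.1.1 j.
have lM : 0 <= l j * M by rewrite mulr_ge0.
have cl : 0 <= c j * l j by rewrite mulr_ge0.
set b := 2^-1 ^+ T.
apply: (@le_trans _ _ (Num.max 0 (l j * (tnth v j - (lot_value v l - p l)) - b * p l)
    - c j * l j)).
  by rewrite lerD2r /gain ge_min lexx orbT.
have b0 : 0 <= b by rewrite exprn_ge0// invr_ge0.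
have lq := surrogate_price_le p0 j lb.1; rewrite -/q in lq.
have {}lq : b * (l j * q j) <= b * p l by rewrite ler_wpM2l.
have UM : tnth v j - c j - b * q j - (lot_value v l - p l) <= M.
  apply: lerB.
    apply: le_trans (choice_utility_ge _ v jA).
    by rewrite /scaled_prices -/b; lra.
  apply: choice_utility_le => [|k _]; first exact: (best_utility_ge0 pB v0 lb).
  apply: le_trans (surrogate_utility_le_best pB v0 lb k).
  by rewrite /scaled_prices expr0 mul1r -/q; have := c0 k; lra.
have {}UM := ler_wpM2l l0 UM.
rewrite lerBlDr ge_max; apply/andP; split; first by rewrite addr_ge0.
move: UM; rewrite /= !mulrBr; lra.
Qed.

End Gain.

(** * Choice probabilities: measurability and finite sums *)

(** The set is a finite union, over the accepted patterns [f] of truth values, of finite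
    intersections of test sets and their complements. *)
Lemma measurable_finite_test (d : measure_display) (T : measurableType d)
    (I : finType) (B : I -> T -> bool) (P : {ffun I -> bool} -> Prop) :
  (forall i, measurable [set x | B i x]) ->
  measurable [set x | P [ffun i => B i x]].
Proof.
move=> mB.
rewrite (_ : [set x | _] = \bigcup_(f in [set f | P f])
    \bigcap_(i in setT) (if f i then [set x | B i x] else ~` [set x | B i x])).
  apply: fin_bigcup_measurable => [|f _]; first exact: finite_finset.
  apply: fin_bigcap_measurable => [|i _]; first exact: finite_finset.
  by case: (f i); [exact: mB|apply: measurableC; exact: mB].
apply/seteqP; split => [x Px|x [f Pf fx]].
  by exists [ffun i => B i x] => // i _; rewrite ffunE; case: ifPn => //= /negP.
rewrite /= (_ : [ffun i => B i x] = f)//; apply/ffunP => i; rewrite ffunE.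
by have := fx i Logic.I; case: (f i) => //= /negP/negbTE.
Qed.

Section ChoiceProbability.
Variables (R : realType) (m : nat) (D : probability (valuation R m) R).
Variables (pr : 'I_m -> R) (A : {set 'I_m}).

Lemma measurable_item_choice (o : option 'I_m) :
  measurable [set v | item_choice pr v A = o].
Proof.
(* [None] stands for buying nothing at utility zero, so that both conditions in [item_choice] become
   comparisons of the same form. *)
pose w (v : valuation R m) (k : option 'I_m) : R :=
  if k is Some j then tnth v j - pr j else 0.
pose B (i : option 'I_m * 'I_m) v := w v i.1 <= tnth v i.2 - pr i.2.
pose P (f : {ffun option 'I_m * 'I_m -> bool}) :=
  [pick j in A | f (None, j) && [forall k in A, f (Some k, j)]] = o.
rewrite (_ : [set v | _] = [set v | P [ffun i => B i v]]); last first.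
  apply: eq_set => v; rewrite /P /item_choice; congr (_ = _); apply: eq_pick => j.
  rewrite ffunE; congr (_ && (_ && _)); apply: eq_forallb => k.
  by rewrite ffunE.
have mt j : measurable_fun setT (fun v : valuation R m => tnth v j - pr j).
  by apply: measurable_funB => //; exact: measurable_tnth.
have mw k : measurable_fun setT (w^~ k).
  by case: k => [k|]/=; [exact: mt|exact: measurable_cst].
apply: measurable_finite_test => -[k j]; rewrite -[X in measurable X]setTI.
exact: (measurable_fun_le measurableT (mw k) (mt j)).
Qed.

Definition choice_prob (o : option 'I_m) : R :=
  fine (D [set v | item_choice pr v A = o]).

Lemma choice_prob_ge0 (o : option 'I_m) : 0 <= choice_prob o.
Proof. exact: fine_ge0. Qed.

Lemma integral_item_choice (F : option 'I_m -> R) :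
  (\int[D]_v (F (item_choice pr v A))%:E
   = (\sum_(o : option 'I_m) choice_prob o * F o)%:E)%E.
Proof.
pose S o := [set v | item_choice pr v A = o].
have mS o : measurable (S o) by exact: measurable_item_choice.
transitivity (\int[D]_v (\sum_(o : option 'I_m) (F o)%:E * (\1_(S o) v)%:E))%E.
  apply: eq_integral => v _.
  rewrite (bigD1 (item_choice pr v A))//= indicE mem_set// mule1 big1 ?adde0//.
  by move=> o /eqP oP; rewrite indicE memNset ?mule0// => /esym.
rewrite integral_sum//; last first.
  by move=> o; apply: integrableZl => //; exact: integrable_indic.
rewrite -sumEFin; apply: eq_bigr => o _.
rewrite integralZl//; last exact: integrable_indic.
rewrite integral_indic// setIT muleC EFinM /choice_prob fineK//.
by apply: fin_num_measure; exact: mS.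
Qed.

Lemma sum_choice_prob : \sum_(o : option 'I_m) choice_prob o = 1.
Proof.
have := integral_item_choice (fun=> 1).
rewrite integral_cst// mul1e [X in X = _]probability_setT => -[->].
by apply: eq_bigr => o _; rewrite mulr1.
Qed.

End ChoiceProbability.

(** * Sequential revenue as a real number *)

Section RealRevenue.
Variables (R : realType) (n m : nat) (D : 'I_n -> probability (valuation R m) R).

(** Each stage has finitely many outcomes, so the iterated integrals of [seq_rev] become finite sums
    in which the distributions enter only through choice probabilities. *)
Fixpoint real_seq_rev (pr : 'I_n -> 'I_m -> R) (s : seq 'I_n) (A : {set 'I_m}) : R :=
  if s is i :: s' then
    \sum_(o : option 'I_m) choice_prob (D i) (pr i) A o *
      ((if o is Some j then pr i j else 0)
       + real_seq_rev pr s' (if o is Some j then A :\ j else A))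
  else 0.

Lemma seq_revE (pr : 'I_n -> 'I_m -> R) (s : seq 'I_n) (A : {set 'I_m}) :
  seq_rev D pr s A = (real_seq_rev pr s A)%:E.
Proof.
elim: s A => [//|i s IH] A /=.
rewrite -integral_item_choice; apply: eq_integral => v _.
by case: item_choice => [j|]; rewrite IH ?EFinD// add0r.
Qed.

Lemma eq_real_seq_rev (pr pr' : 'I_n -> 'I_m -> R) (s : seq 'I_n) (A : {set 'I_m}) :
  {in s, forall i, pr i = pr' i} -> real_seq_rev pr s A = real_seq_rev pr' s A.
Proof.
elim: s A => [//|i s IH] A prE /=.
rewrite (prE i) ?mem_head//; apply: eq_bigr => o _.
by rewrite IH// => k ks; apply: prE; rewrite in_cons ks orbT.
Qed.

Lemma real_seq_rev_ge0 (pr : 'I_n -> 'I_m -> R) (s : seq 'I_n) (A : {set 'I_m}) :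
  (forall i j, 0 <= pr i j) -> 0 <= real_seq_rev pr s A.
Proof.
move=> pr0; elim: s A => [//|i s IH] A /=.
apply: sumr_ge0 => o _; rewrite mulr_ge0 ?choice_prob_ge0// addr_ge0//.
by case: o.
Qed.

End RealRevenue.

(** * Chaining single-buyer guarantees over the buyers *)

Section Composition.
Variables (R : realType) (m : nat).

(* [mu] is the distribution of the set of items left for the buyer, [c] the
   cost of the items, and [G j] the contribution of item [j] to the revenue
   under allocation constraint [x].  The price may depend on [mu], but [G] may
   not. *)
Definition profit_guarantee (D : probability (valuation R m) R)
    (x : 'I_m -> R) (T : nat) (G : 'I_m -> R) : Prop :=
  forall (mu : {set 'I_m} -> R) (c : 'I_m -> R),
    (forall A, 0 <= mu A) -> (forall j, 0 <= c j) ->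
  exists pr : 'I_m -> R, (forall j, 0 <= pr j) /\
    \sum_A mu A * (\sum_(j in A) (G j - c j * x j)) <=
    T%:R * \sum_A mu A *
      \sum_(o : option 'I_m) choice_prob D pr A o *
        (if o is Some j then pr j - c j else 0).

Lemma sum_setD1 (A : {set 'I_m}) (w : 'I_m -> R) (j : 'I_m) (M : R) :
  0 <= M -> w j <= M ->
  \sum_(k in A) w k - M <= \sum_(k in A :\ j) w k.
Proof.
move=> M0 wM; have [jA|jA] := boolP (j \in A).
  by rewrite (big_setD1 j)//=; lra.
suff -> : A :\ j = A by lra.
by apply/setP => k; rewrite !inE; case: eqP => // ->; rewrite (negbTE jA).
Qed.

Variables (n : nat) (D : 'I_n -> probability (valuation R m) R).
Variables (x G : 'I_n -> 'I_m -> R) (T : nat).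
Hypothesis guar : forall i, profit_guarantee (D i) (x i) T (G i).

(** Induction on the buyers, with the weights [mu] of the available sets generalized. The guarantee
    at [mu] prices the first buyer; the induction hypothesis at the updated weights prices the
    others. The assumption on subsequences passes to tails; it bounds what later buyers lose when
    one item is sold. *)
Lemma sequential_revenue_ge (c : 'I_m -> R) (s : seq 'I_n)
    (mu : {set 'I_m} -> R) :
  (forall j, 0 <= c j) -> (forall A, 0 <= mu A) -> uniq s ->
  (forall s' j, subseq s' s ->
    \sum_(i <- s') (G i j - c j * x i j) <= T%:R * c j) ->
  exists pr : 'I_n -> 'I_m -> R, (forall i j, 0 <= pr i j) /\
    \sum_A mu A * (\sum_(j in A) \sum_(i <- s) (G i j - c j * x i j)) <=
    T%:R * \sum_A mu A * real_seq_rev D pr s A.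
Proof.
move=> c0; elim: s mu => [|i s IH] mu mu0 us ws.
  exists (fun _ _ => 0); split=> //.
  rewrite !big1 ?mulr0// => A _; first by rewrite mulr0.
  by rewrite big1 ?mulr0// => j _; rewrite big_nil.
have /andP[si us'] := us.
pose w j := \sum_(k <- s) (G k j - c j * x k j).
have [q [q0 Hq]] := guar i mu0 c0.
pose next A (o : option 'I_m) := if o is Some j then A :\ j else A.
pose pay (o : option 'I_m) := if o is Some j then q j else 0.
pose P A o := choice_prob (D i) q A o.
(* Weights of the sets left after buyer [i]. They depend only on [mu] and [q], so the later prices
   are fixed in advance. *)
pose mu' B := \sum_A \sum_(o : option 'I_m) mu A * P A o * (next A o == B)%:R.
have mu'0 B : 0 <= mu' B.
  apply: sumr_ge0 => A _; apply: sumr_ge0 => o _.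
  by rewrite !mulr_ge0 ?ler0n//; exact: choice_prob_ge0.
have mu'E f : \sum_B mu' B * f B = \sum_A mu A * \sum_o P A o * f (next A o).
  under eq_bigr do rewrite mulr_suml.
  rewrite exchange_big; apply: eq_bigr => A _/=.
  under eq_bigr do rewrite mulr_suml.
  rewrite exchange_big mulr_sumr; apply: eq_bigr => o _ /=.
  rewrite (bigD1 (next A o))//= eqxx mulr1 -mulrA big1 ?addr0// => B /negbTE nB.
  by rewrite eq_sym nB mulr0 mul0r.
have [pr' [pr'0 Hpr']] := IH mu' mu'0 us'
  (fun s' j ss' => ws s' j (subseq_trans ss' (subseq_cons s i))).
rewrite !mu'E in Hpr'.
exists (fun k => if k == i then q else pr' k); split=> [k j|].
  by case: ifP.
pose base A := \sum_o P A o * (if o is Some j then q j - c j else 0).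
apply: (@le_trans _ _ (T%:R * (\sum_A mu A * base A)
   + \sum_A mu A * \sum_(j in A) w j)).
  apply: le_trans (lerD Hq (lexx _)).
  rewrite le_eqVlt -big_split/=; apply/orP; left; apply/eqP.
  apply: eq_bigr => A _; rewrite -mulrDr; congr (_ * _).
  by rewrite -big_split/=; apply: eq_bigr => j _; rewrite big_cons.
apply: (@le_trans _ _ (T%:R * (\sum_A mu A * \sum_o P A o * pay o)
   + \sum_A mu A * \sum_o P A o * \sum_(j in next A o) w j)).
  rewrite !mulr_sumr -!big_split/=; apply: ler_sum => A _.
  have nextW : T%:R * base A + \sum_(j in A) w j <=
      T%:R * (\sum_o P A o * pay o) + \sum_o P A o * \sum_(j in next A o) w j.
    have -> : \sum_(j in A) w j = \sum_o P A o * \sum_(j in A) w j.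
      by rewrite -mulr_suml sum_choice_prob mul1r.
    rewrite /base !mulr_sumr -!big_split/=; apply: ler_sum => o _.
    rewrite -/(P A o) mulrCA -mulrDr [X in _ <= X + _]mulrCA -mulrDr.
    rewrite ler_wpM2l ?choice_prob_ge0//.
    case: o => [j|]; rewrite /pay /next ?lexx//.
    (* Selling [j] brings [c j] more revenue than profit; [T] times this covers the loss of the
       later contributions of [j]. *)
    have : \sum_(k in A) w k - T%:R * c j <= \sum_(k in A :\ j) w k.
      by apply: sum_setD1; [rewrite mulr_ge0|exact: (ws s j (subseq_cons s i))].
    rewrite mulrBr; lra.
  have := ler_wpM2l (mu0 A) nextW.
  rewrite !mulrDr; lra.
apply: le_trans (lerD (lexx _) Hpr') _.
rewrite -mulrDr ler_wpM2l// -big_split/=; apply: ler_sum => A _.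
rewrite -mulrDr ler_wpM2l// -big_split/=; apply: ler_sum => o _.
rewrite eqxx -/(P A o) -mulrDr ler_wpM2l ?choice_prob_ge0// lerD//.
(* Buyer [i] does not occur in [s], so inserting her prices leaves the later revenue unchanged. *)
rewrite (@eq_real_seq_rev _ _ _ _ _ pr')// => k ks.
by case: eqP => // ki; move: si; rewrite -ki ks.
Qed.

(* The cost of an item is half of its total contribution to the benchmark: if
   the item is likely to sell, its price covers the cost; otherwise it is
   still available to most buyers, each of whom then yields a profit. *)
Lemma sequential_revenue_ge_half : (2 <= T)%N ->
  (forall i j, 0 <= x i j) -> (forall j, \sum_(i < n) x i j <= 1) ->
  (forall i j, 0 <= G i j) ->
  ((\sum_(i < n) \sum_(j < m) G i j)%:E <= (2 * T%:R)%:E * SRev D)%E.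
Proof.
move=> T2 x0 x1 G0.
pose c j := (\sum_(i < n) G i j) / 2.
have c0 j : 0 <= c j by rewrite divr_ge0// sumr_ge0.
pose mu (A : {set 'I_m}) : R := (A == [set: 'I_m]%SET)%:R.
have [|||pr [pr0]] := @sequential_revenue_ge c (enum 'I_n) mu c0.
- by move=> A; rewrite ler0n.
- exact: enum_uniq.
- move=> s' j ss'.
  apply: (@le_trans _ _ (\sum_(i <- s') G i j)).
    by apply: ler_sum => i _; rewrite gerBl mulr_ge0.
  (* The total contribution of [j] is [2 * c j], hence at most [T * c j] because [T >= 2]. *)
  apply: (@le_trans _ _ (2 * c j)); last by rewrite ler_wpM2r// ler_nat.
  rewrite /c mulrC divfK//.
  rewrite big_uniq/=; last by rewrite (subseq_uniq ss')// enum_uniq.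
  by rewrite big_mkcond/=; apply: ler_sum => i _; case: ifP.
have mu1 f : \sum_A mu A * f A = f [set: 'I_m]%SET.
  rewrite (bigD1 [set: 'I_m]%SET)//= /mu eqxx mul1r big1 ?addr0// => A /negbTE ->.
  by rewrite mul0r.
rewrite !mu1 => H.
have SR : ((real_seq_rev D pr (enum 'I_n) [set: 'I_m]%SET)%:E <= SRev D)%E.
  by apply: ereal_sup_ubound; exists (enum 'I_n), pr; split; rewrite ?seq_revE.
apply: (@le_trans _ _ ((2 * T%:R)%:E
   * (real_seq_rev D pr (enum 'I_n) [set: 'I_m]%SET)%:E)%E); last first.
  by apply: lee_wpmul2l => //; rewrite lee_fin mulr_ge0.
rewrite -EFinM lee_fin -mulrA.
apply: le_trans (ler_wpM2l _ H); last by [].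
rewrite exchange_big mulr_sumr/= [leRHS](eq_bigl xpredT); last first.
  by move=> j; rewrite inE.
(* Per item, the contributions total [2 * c j], and the allocation constraint limits the cost to
   [c j]; half of the contributions remains. *)
apply: ler_sum => j _; rewrite big_enum sumrB -mulr_sumr.
have : c j * \sum_(i < n) x i j <= c j * 1 by rewrite ler_wpM2l.
rewrite {2}/c; lra.
Qed.

End Composition.

(** * Integrals, averaging, and sums of suprema *)

Section Integration.
Context {d : measure_display} {T : measurableType d} {R : realType}.

Lemma integrable_bounded (mu : {measure set T -> \bar R}) (f : T -> R) (M : R) :
  (mu setT < +oo)%E -> measurable_fun setT f -> (forall x, `|f x| <= M) ->
  mu.-integrable setT (EFin \o f).
Proof.
move=> muT mf fM; apply: measurable_bounded_integrable => //.
exists M; split; first exact: num_real.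
by move=> y My x _; apply: le_trans (ltW My).
Qed.

Lemma integrable_lincomb (mu : {measure set T -> \bar R}) (I : Type) (s : seq I)
    (k : I -> R) (f : I -> T -> R) :
  (forall i, mu.-integrable setT (EFin \o f i)) ->
  mu.-integrable setT (EFin \o (fun x => \sum_(i <- s) k i * f i x)).
Proof.
move=> intf.
rewrite (_ : _ \o _ = fun x => (\sum_(i <- s) (k i)%:E * (EFin \o f i) x)%E).
  by apply: integrable_sum => // i _; exact: integrableZl.
by apply/funext => x /=; rewrite sumEFin.
Qed.

Lemma Rintegral_lincomb (mu : {measure set T -> \bar R}) (I : Type) (s : seq I)
    (k : I -> R) (f : I -> T -> R) :
  (forall i, mu.-integrable setT (EFin \o f i)) ->
  \int[mu]_x (\sum_(i <- s) k i * f i x) = \sum_(i <- s) k i * \int[mu]_x f i x.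
Proof.
move=> intf; elim: s => [|i s IH].
  under eq_Rintegral do rewrite big_nil.
  by rewrite big_nil Rintegral_cst// mul0r.
under eq_Rintegral do rewrite big_cons.
rewrite big_cons RintegralD//; first last.
- exact: integrable_lincomb.
- by have := @integrable_lincomb mu I [:: i] k f intf; congr (_ .-integrable _ _);
    apply/funext => x /=; rewrite big_seq1.
by rewrite RintegralZl// IH.
Qed.

(** Were [f] below its mean [k] everywhere, [k - f] would be positive with integral zero, so the
    whole space would be a null set. This serves to pick one pricing out of a random one. *)
Lemma exists_integral_le (P : probability T R) (f : T -> \bar R) :
  P.-integrable setT f -> exists x, (\int[P]_y f y <= f x)%E.
Proof.
move=> intf; have fk := integrable_fin_num measurableT intf.
set k := (\int[P]_y f y)%E in fk *.
apply: contrapT => /forallNP noX.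
have fx x : (f x < k)%E by rewrite ltNge; apply/negP; exact: noX.
have mf := measurable_int P intf.
have kE : k = (fine k)%:E by rewrite fineK.
have intk : P.-integrable setT (EFin \o cst (fine k)).
  exact: finite_measure_integrable_cst.
have g0 x : (0 < (EFin \o cst (fine k)) x - f x)%E by rewrite /= -kE sube_gt0.
have : (\int[P]_x `|(EFin \o cst (fine k)) x - f x| = 0)%E.
  under eq_integral do rewrite gee0_abs ?ltW//.
  rewrite integralB// -/k (_ : EFin \o cst (fine k) = cst k); last first.
    by apply/funext => x /=; rewrite -kE.
  by rewrite integral_cst// [X in (_ * X)%E]probability_setT mule1 subee.
move/(ae_eq_integral_abs P measurableT (emeasurable_funB (measurable_int P intk) mf)).
move=> [N [mN N0 sN]].
have : N = setT.
  apply/seteqP; split=> // x _; apply: sN => /(_ Logic.I) /eqP.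
  by rewrite gt_eqF//; exact: g0.
move=> NT; have := @probability_setT _ _ _ P; rewrite -NT [X in X = _]N0 => /eqP.
by rewrite eq_sym onee_eq0.
Qed.

End Integration.

Lemma sum_ereal_sup_le (R : realType) (I : eqType) (s : seq I) (S : I -> set R)
    (M : \bar R) :
  uniq s -> (forall i, S i !=set0) ->
  (forall r : I -> R, (forall i, S i (r i)) -> ((\sum_(i <- s) r i)%:E <= M)%E) ->
  (\sum_(i <- s) ereal_sup (EFin @` S i) <= M)%E.
Proof.
move=> us S0 H; pose r0 i := projT1 (cid (S0 i)).
(* The number [a] accumulates the elements chosen so far while the suprema are treated one at a
   time. *)
suff gen a : (forall r : I -> R, (forall i, S i (r i)) ->
    ((a + \sum_(i <- s) r i)%:E <= M)%E) ->
    (a%:E + \sum_(i <- s) ereal_sup (EFin @` S i) <= M)%E.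
  by rewrite -[X in (X <= _)%E]add0e; apply: gen => r Sr; rewrite add0r; exact: H.
elim: s us a {H} => [|i s IH] /=.
  move=> _ a /(_ r0); rewrite !big_nil addr0 adde0; apply => i.
  exact: (projT2 (cid (S0 i))).
move=> /andP[si us] a H; rewrite big_cons.
set Y := (\sum_(j <- s) _)%E.
have Hb b : S i b -> (b%:E + (a%:E + Y) <= M)%E.
  move=> Sb; rewrite addeA -EFinD; apply: IH => // r Sr.
  have /H : forall k, S k (if k == i then b else r k) by move=> k; case: eqP => [->|].
  rewrite big_cons eqxx => Hr; rewrite -addrA addrCA; move: Hr.
  rewrite (@eq_big_seq _ _ _ _ s _ r)//= => k ks.
  by case: eqP => // ki; move: si; rewrite -ki ks.
(* The remaining suprema may be infinite; subtraction is available only in the finite case, and the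
   value [+oo] forces [M] to be [+oo]. *)
rewrite addeCA; case: (a%:E + Y)%E Hb => [y| |] Hb.
- rewrite -leeBrDr//; apply: ge_ereal_sup => _ [b Sb <-].
  by rewrite leeBrDr//; exact: Hb.
- have [b Sb] := S0 i; have := Hb b Sb; rewrite addey// leye_eq => /eqP ->.
  exact: leey.
- by rewrite addeNy leNye.
Qed.

Lemma measurable_nonneg_val (R : realType) (m : nat) :
  measurable (@nonneg_val R m).
Proof.
rewrite (_ : @nonneg_val R m =
    \bigcap_(j in [set: 'I_m]) [set v : valuation R m | 0 <= tnth v j]).
  apply: fin_bigcap_measurable => [|j _]; first exact: finite_finset.
  rewrite -[X in measurable X]setTI.
  exact: (measurable_fun_le measurableT (measurable_cst _) (measurable_tnth j)).
by apply/seteqP; split=> [v v0 j _|v v0 j]; [exact: v0|exact: (v0 j Logic.I)].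
Qed.

Lemma choice_profit_scaled_ge0 (R : realType) (m : nat) (c q : 'I_m -> R) (t : nat)
    (v : valuation R m) (A : {set 'I_m}) :
  (forall j, 0 <= q j) -> 0 <= choice_profit (scaled_prices c q t) c v A.
Proof.
move=> q0; rewrite /choice_profit /scaled_prices; case: item_choice => // j.
by rewrite addrC addKr mulr_ge0// exprn_ge0// invr_ge0.
Qed.

Lemma integrable_item_choice (R : realType) (m : nat)
    (D : probability (valuation R m) R) (pr : 'I_m -> R) (A : {set 'I_m})
    (F : option 'I_m -> R) :
  D.-integrable setT (EFin \o (fun v => F (item_choice pr v A))).
Proof.
rewrite (_ : (fun v => _) = (fun v => \sum_(o <- enum {: option 'I_m})
    F o * \1_[set v | item_choice pr v A = o] v)).
  apply: integrable_lincomb => o.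
  by apply: integrable_indic; exact: measurable_item_choice.
apply/funext => v; rewrite big_enum/= (bigD1 (item_choice pr v A))//=.
rewrite indicE mem_set// mulr1 big1 ?addr0// => o /eqP oP.
by rewrite indicE memNset ?mulr0// => /esym.
Qed.

Lemma sum_sets_weight (R : realType) (m : nat) (mu : {set 'I_m} -> R) (f : 'I_m -> R) :
  \sum_A mu A * (\sum_(j in A) f j)
  = \sum_(j <- enum 'I_m) (\sum_(A : {set 'I_m} | j \in A) mu A) * f j.
Proof.
rewrite big_enum/=.
under eq_bigr do rewrite mulr_sumr.
rewrite (exchange_big_dep xpredT)//=; apply: eq_bigr => j _.
by rewrite mulr_suml.
Qed.

(** * One buyer facing a random buy-many pricing *)

Section SingleBuyer.
Variables (R : realType) (m : nat) (D : probability (valuation R m) R).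
Variables (x : 'I_m -> R) (d : measure_display) (Theta : measurableType d).
Variables (Q : probability Theta R) (p : Theta -> pricing R m).
Variable sel : Theta -> valuation R m -> ('I_m -> R).
Hypothesis D0 : D (@nonneg_val R m) = 1%E.
Hypothesis pB : forall th, nonneg_pricing (p th) /\ buy_many (p th).
Hypothesis best : forall th v, nonneg_val v -> best_lottery (p th) v (sel th v).
Hypothesis mp : measurable_fun setT
  (fun z : Theta * valuation R m => p z.1 (sel z.1 z.2)).
Hypothesis ms : forall j, measurable_fun setT
  (fun z : Theta * valuation R m => sel z.1 z.2 j).
Hypothesis sel_le : forall j, (\int[(Q \x D)%E]_z (sel z.1 z.2 j)%:E <= (x j)%:E)%E.
Variables (T : nat) (N : R).
Hypothesis N0 : 0 <= N.

(** The selection is known to be optimal only on nonnegative valuations, which have probability one.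
    Multiplying by this indicator makes the integrands bounded everywhere. *)
Let nn (v : valuation R m) : R := \1_(@nonneg_val R m) v.

Let nn1 v : nonneg_val v -> nn v = 1.
Proof. by move=> v0; rewrite /nn indicE mem_set. Qed.

Let nn0 v : ~ nonneg_val v -> nn v = 0.
Proof. by move=> v0; rewrite /nn indicE memNset. Qed.

Definition truncated_gain (j : 'I_m) (z : Theta * valuation R m) : R :=
  nn z.2 * gain (p z.1) (2^-1 ^+ T) N z.2 (sel z.1 z.2) j.

Let alloc (j : 'I_m) (z : Theta * valuation R m) : R := nn z.2 * sel z.1 z.2 j.

Let measurable_nn : measurable_fun setT (fun z : Theta * valuation R m => nn z.2).
Proof.
apply: (measurableT_comp _ measurable_snd).
exact: (measurable_indic (@measurable_nonneg_val R m)).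
Qed.

Let measurable_alloc j : measurable_fun setT (alloc j).
Proof. exact: measurable_funM. Qed.

Let measurable_gain j : measurable_fun setT (truncated_gain j).
Proof.
apply: measurable_funM => //.
have mv k : measurable_fun setT (fun z : Theta * valuation R m => tnth z.2 k).
  exact: (measurableT_comp (measurable_tnth k) measurable_snd).
apply: measurable_minr; first exact: measurable_cst.
apply: measurable_maxr; first exact: measurable_cst.
apply: measurable_funB; last first.
  by apply: measurable_funM => //; exact: measurable_cst.
apply: measurable_funM => //.
apply: measurable_funB => //.
apply: measurable_funB => //.
by apply: measurable_sum => k; apply: measurable_funM.
Qed.

Let gain_bounded j z : 0 <= truncated_gain j z <= N.
Proof.
rewrite /truncated_gain; have [/nn1 ->|/nn0 ->] := pselect (nonneg_val z.2).
  by rewrite mul1r gain_ge0//= gain_le.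
by rewrite mul0r lexx N0.
Qed.

Let alloc_bounded j z : 0 <= alloc j z <= 1.
Proof.
rewrite /alloc; have [v0|/nn0 ->] := pselect (nonneg_val z.2); last first.
  by rewrite mul0r lexx ler01.
rewrite nn1// mul1r; have [[l0 l1] _] := best z.1 v0; rewrite l0/=.
by apply: le_trans l1; rewrite (bigD1 j)//= lerDl sumr_ge0.
Qed.

Let QD_fin : ((Q \x D)%E setT < +oo)%E.
Proof. by rewrite [X in (X < _)%E]probability_setT ltry. Qed.

Let integrable_gain j : (Q \x D)%E.-integrable setT (EFin \o truncated_gain j).
Proof.
apply: (@integrable_bounded _ _ _ _ _ N QD_fin) => // z.
by have /andP[h0 hN] := gain_bounded j z; rewrite ger0_norm.
Qed.

Let integrable_alloc j : (Q \x D)%E.-integrable setT (EFin \o alloc j).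
Proof.
apply: (@integrable_bounded _ _ _ _ _ 1 QD_fin) => // z.
by have /andP[h0 hN] := alloc_bounded j z; rewrite ger0_norm.
Qed.

Lemma ae_eq_nonneg_val (f g : Theta * valuation R m -> \bar R) :
  (forall z, nonneg_val z.2 -> f z = g z) -> ae_eq (Q \x D)%E setT f g.
Proof.
move=> fg; exists (setT `*` ~` @nonneg_val R m); split.
- apply: measurableX => //; apply: measurableC; exact: measurable_nonneg_val.
- transitivity (Q setT * D (~` @nonneg_val R m))%E.
    by apply: product_measure1E => //; apply: measurableC; exact: measurable_nonneg_val.
  rewrite [X in (_ * X)%E](_ : _ = 0%E) ?mule0//.
  by rewrite probability_setC ?D0 ?subee//; exact: measurable_nonneg_val.
- move=> z /= H; split=> // v0; apply: H => _; exact: fg.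
Qed.

Let alloc_le j : \int[(Q \x D)%E]_z alloc j z <= x j.
Proof.
rewrite -lee_fin /Rintegral fineK; last first.
  exact: (integrable_fin_num measurableT (integrable_alloc j)).
apply: le_trans (sel_le j); rewrite le_eqVlt; apply/orP; left; apply/eqP.
apply: ae_eq_integral => //.
- exact/measurable_EFinP.
- exact/measurable_EFinP.
- by apply: ae_eq_nonneg_val => z v0; rewrite /alloc nn1// mul1r.
Qed.

Let integrable_section (mu : {set 'I_m} -> R) (c : 'I_m -> R) th :
  D.-integrable setT (EFin \o (fun v => \sum_A mu A * (\sum_(j in A)
      (truncated_gain j (th, v) - c j * alloc j (th, v))))).
Proof.
under [X in _ \o X]eq_fun do rewrite sum_sets_weight.
apply: integrable_lincomb => j.
have D_fin : (D setT < +oo)%E by rewrite [X in (X < _)%E]probability_setT ltry.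
have ig : D.-integrable setT (EFin \o (fun v => truncated_gain j (th, v))).
  apply: (@integrable_bounded _ _ _ _ _ N D_fin) => [|v].
    exact: (measurable_fun_pair2 th (measurable_gain j)).
  by have /andP[h0 hN] := gain_bounded j (th, v); rewrite ger0_norm.
have ia : D.-integrable setT (EFin \o (fun v => alloc j (th, v))).
  apply: (@integrable_bounded _ _ _ _ _ 1 D_fin) => [|v].
    exact: (measurable_fun_pair2 th (measurable_alloc j)).
  by have /andP[h0 hN] := alloc_bounded j (th, v); rewrite ger0_norm.
exact: (integrableB measurableT ig (integrableZl measurableT (c j) ia)).
Qed.

(** The allocation constraint holds only on average over the random pricing, but the costs turn it
    into a linear penalty. By Fubini the right-hand side averages over [th] to at least the
    left-hand side, so some [th] reaches it. The choice of [th] may depend on [mu] and [c], while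
    the integrated gains do not. *)
Lemma exists_pricing_ge (mu : {set 'I_m} -> R) (c : 'I_m -> R) :
  (forall A, 0 <= mu A) -> (forall j, 0 <= c j) ->
  exists th, \sum_A mu A * (\sum_(j in A)
      (\int[(Q \x D)%E]_z truncated_gain j z - c j * x j)) <=
    \int[D]_v (\sum_A mu A * (\sum_(j in A)
      (truncated_gain j (th, v) - c j * alloc j (th, v)))).
Proof.
move=> mu0 c0.
pose g j z := truncated_gain j z - c j * alloc j z.
have ig j : (Q \x D)%E.-integrable setT (EFin \o g j).
  exact: (integrableB measurableT (integrable_gain j)
    (integrableZl measurableT (c j) (integrable_alloc j))).
pose F z := \sum_A mu A * (\sum_(j in A) g j z).
have FE z : F z = \sum_(j <- enum 'I_m) (\sum_(A : {set 'I_m} | j \in A) mu A) * g j z.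
  exact: sum_sets_weight.
have intF : (Q \x D)%E.-integrable setT (EFin \o F).
  rewrite (_ : F = (fun z => \sum_(j <- enum 'I_m)
      (\sum_(A : {set 'I_m} | j \in A) mu A) * g j z)).
    exact: integrable_lincomb.
  exact/funext.
have [th Hth] := exists_integral_le (integrable_fubini_F intF).
exists th; apply: (@le_trans _ _ (\int[(Q \x D)%E]_z F z)).
  under eq_Rintegral do rewrite FE.
  rewrite Rintegral_lincomb// sum_sets_weight; apply: ler_sum => j _.
  rewrite ler_wpM2l ?sumr_ge0// /g RintegralB//; last first.
    exact: (integrableZl measurableT (c j) (integrable_alloc j)).
  by rewrite lerD2l lerN2 RintegralZl// ler_wpM2l.
rewrite integral12_prod_meas1// in Hth.
rewrite -lee_fin /Rintegral !fineK//.
  exact: (integrable_fin_num measurableT (integrable_section mu c th)).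
exact: (integrable_fin_num measurableT intF).
Qed.

Lemma single_buyer_guarantee : (0 < T)%N ->
  profit_guarantee D x T (fun j => \int[(Q \x D)%E]_z truncated_gain j z).
Proof.
move=> T0 mu c mu0 c0; have [th Hth] := exists_pricing_ge mu0 c0.
have [p0 pb] := pB th.
pose q := surrogate_price (p th).
have q0 j : 0 <= q j by exact: surrogate_price_ge0.
pose pr (t : 'I_T) := scaled_prices c q t.+1.
have pr0 t j : 0 <= pr t j.
  by rewrite addr_ge0// mulr_ge0// exprn_ge0// invr_ge0.
pose prof t A := \sum_(o : option 'I_m) choice_prob D (pr t) A o *
  (if o is Some j then pr t j - c j else 0).
have profE t A : \int[D]_v choice_profit (pr t) c v A = prof t A.
  by rewrite /Rintegral (integral_item_choice D (pr t) A
    (fun o => if o is Some j then pr t j - c j else 0)).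
set K := (X in X <= _) in Hth.
(* The bound [gain_le_profit] is integrated over the valuations for the chosen [th]. Where [v] is
   not nonnegative, gains and allocations vanish, while profits are nonnegative. *)
have Hsum : K <= \sum_(t < T) \sum_A mu A * prof t A.
  apply: (le_trans Hth).
  pose f (i : {set 'I_m} * 'I_T) v := choice_profit (pr i.2) c v i.1.
  have intf i : D.-integrable setT (EFin \o f i).
    exact: (integrable_item_choice D (pr i.2) i.1
      (fun o => if o is Some j then pr i.2 j - c j else 0)).
  apply: (@le_trans _ _
    (\int[D]_v \sum_(i <- enum {: {set 'I_m} * 'I_T}) mu i.1 * f i v)).
    apply: le_Rintegral => //.
      exact: integrable_lincomb.
    move=> v _.
    have -> : \sum_(i <- enum {: {set 'I_m} * 'I_T}) mu i.1 * f i v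
        = \sum_A mu A * \sum_(t < T) f (A, t) v.
      rewrite big_enum/= -(pair_bigA _ (fun A t => mu A * f (A, t) v))/=.
      by apply: eq_bigr => A _; rewrite mulr_sumr.
    apply: ler_sum => A _; rewrite ler_wpM2l//.
    have [v0|/nn0 nv0] := pselect (nonneg_val v).
      rewrite /truncated_gain /alloc /= (nn1 v0).
      under eq_bigr do rewrite !mul1r.
      exact: (gain_le_profit p0 pb v0 (best th v0) N T A c0).
    rewrite /truncated_gain /alloc /= nv0 big1 => [|j _]; last first.
      by rewrite !mul0r mulr0 subrr.
    by apply: sumr_ge0 => t _; exact: choice_profit_scaled_ge0.
  rewrite Rintegral_lincomb// big_enum/=.
  rewrite -(pair_bigA _ (fun A t => mu A * \int[D]_v f (A, t) v))/= exchange_big/=.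
  by rewrite le_eqVlt; apply/orP; left; apply/eqP; apply: eq_bigr => t _;
    apply: eq_bigr => A _; rewrite profE.
(* The best of the [T] price levels makes at least a [1 / T] share of their total profit; this is
   the source of the logarithmic factor. *)
have [t Ht] : exists t, K <= T%:R * \sum_A mu A * prof t A.
  apply: contrapT => /forallNP noT.
  have : \sum_(t < T) T%:R * (\sum_A mu A * prof t A) < \sum_(t < T) K.
    apply: ltr_sum => [|t _].
      by apply/hasP; exists (Ordinal T0); rewrite ?mem_index_enum.
    by rewrite ltNge; apply/negP; exact: noT.
  rewrite -mulr_sumr sumr_const card_ord -[ltRHS]mulr_natl ltr_pM2l ?ltr0n//.
  by rewrite ltNge Hsum.
by exists (pr t); split.
Qed.

Lemma truncated_gain_Rintegral_ge0 j : 0 <= \int[(Q \x D)%E]_z truncated_gain j z.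
Proof. by apply: Rintegral_ge0 => z _; have /andP[] := gain_bounded j z. Qed.

Lemma le_sum_truncated_gain : m%:R * 2^-1 ^+ T <= 2^-1 :> R ->
  ((\int[(Q \x D)%E]_z (nn z.2 * Num.min N (p z.1 (sel z.1 z.2) / 2))%:E)%E <=
  (\sum_(j < m) \int[(Q \x D)%E]_z truncated_gain j z)%:E)%E.
Proof.
move=> mT.
pose f z := \sum_(j <- enum 'I_m) 1 * truncated_gain j z.
have intf : (Q \x D)%E.-integrable setT (EFin \o f) by exact: integrable_lincomb.
have -> : \sum_(j < m) \int[(Q \x D)%E]_z truncated_gain j z = \int[(Q \x D)%E]_z f z.
  by rewrite Rintegral_lincomb// big_enum/=; under [RHS]eq_bigr do rewrite mul1r.
rewrite /Rintegral fineK; last exact: (integrable_fin_num measurableT intf).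
apply: ge0_le_integral => //.
- move=> z _; rewrite lee_fin; have [v0|/nn0 ->] := pselect (nonneg_val z.2).
    rewrite nn1// mul1r le_min N0 divr_ge0//.
    exact: (pB z.1).1 (best z.1 v0).1.
  by rewrite mul0r.
- apply/measurable_EFinP; apply: measurable_funM => //.
  apply: measurable_minr; first exact: measurable_cst.
  by apply: measurable_funM => //; exact: measurable_cst.
- exact: (measurable_int _ intf).
move=> z _; rewrite lee_fin /f big_enum/= /truncated_gain.
have [v0|/nn0 ->] := pselect (nonneg_val z.2); last first.
  by rewrite mul0r; apply: sumr_ge0 => j _; rewrite mul0r mulr0.
rewrite nn1// mul1r; under eq_bigr do rewrite !mul1r.
exact: (sum_gain_ge (pB z.1).1 (pB z.1).2 v0 (best z.1 v0) N0 mT).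
Qed.

End SingleBuyer.

(** * From truncated contributions to the ex-ante bound *)

(** [BuyManyRev] may be infinite or unattained, so it is compared with a supremum of real
    certificates. The factor 2 makes up for the half of the price lost in [sum_gain_ge]. *)
Definition guaranteed_revenues (R : realType) (m : nat)
    (D : probability (valuation R m) R) (x : 'I_m -> R) (T : nat) : set R :=
  [set r | exists G : 'I_m -> R,
    [/\ forall j, 0 <= G j, profit_guarantee D x T G & r = 2 * \sum_(j < m) G j]].

(** Zero contributions are certified by selling at cost, which makes no profit. *)
Lemma guaranteed_revenues_neq0 (R : realType) (m : nat)
    (D : probability (valuation R m) R) (x : 'I_m -> R) (T : nat) :
  (forall j, 0 <= x j) -> guaranteed_revenues D x T !=set0.
Proof.
move=> x0; exists (2 * \sum_(j < m) 0), (fun=> 0); split=> // mu c mu0 c0.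
exists c; split=> //.
apply: (@le_trans _ _ 0).
  apply: sumr_le0 => A _; rewrite mulr_ge0_le0//; apply: sumr_le0 => j _.
  by rewrite sub0r oppr_le0 mulr_ge0.
rewrite big1 ?mulr0// => A _; rewrite big1 ?mulr0// => -[j|] _; last by rewrite mulr0.
by rewrite subrr mulr0.
Qed.

(** Payments need not be integrable. With half of the payment capped at [k], the gains capped at [k]
    form a certificate; monotone convergence in [k] recovers the full revenue. *)
Lemma BuyManyRev_le_sup (R : realType) (m : nat)
    (D : probability (valuation R m) R) (x : 'I_m -> R) (T : nat) :
  D (@nonneg_val R m) = 1%E -> (0 < T)%N -> m%:R * 2^-1 ^+ T <= 2^-1 :> R ->
  (BuyManyRev D x <= ereal_sup (EFin @` guaranteed_revenues D x T))%E.
Proof.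
move=> D0 T0 mT; apply: ge_ereal_sup => r.
move=> [dT [Th [Q [p [sel [pB best [mp ms] sel_le ->]]]]]].
set M := ereal_sup _.
pose nn (z : Th * valuation R m) : R := \1_(@nonneg_val R m) z.2.
pose pay (z : Th * valuation R m) := p z.1 (sel z.1 z.2).
pose u (k : nat) z := nn z * Num.min k%:R (pay z / 2).
have mnn : measurable_fun setT nn.
  apply: (measurableT_comp _ measurable_snd).
  exact: (measurable_indic (@measurable_nonneg_val R m)).
have pay0 z : nonneg_val z.2 -> 0 <= pay z.
  by move=> v0; exact: (pB z.1).1 (best z.1 z.2 v0).1.
have nnE z : nonneg_val z.2 -> nn z = 1.
  by move=> v0; rewrite /nn indicE mem_set.
have nnE0 z : ~ nonneg_val z.2 -> nn z = 0.
  by move=> v0; rewrite /nn indicE memNset.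
have meas_u k : measurable_fun setT (u k).
  apply: measurable_funM => //.
  apply: measurable_minr; first exact: measurable_cst.
  by apply: measurable_funM => //; exact: measurable_cst.
have u0 k z : 0 <= u k z.
  rewrite /u; have [v0|v0] := pselect (nonneg_val z.2).
    by rewrite nnE// mul1r le_min ler0n divr_ge0// pay0.
  by rewrite nnE0// mul0r.
pose u2 k z := (2%:E * (u k z)%:E)%E.
have mu2 k : measurable_fun setT (u2 k).
  by apply: emeasurable_funM; [exact: measurable_cst|exact/measurable_EFinP].
have u20 k z : (0 <= u2 k z)%E by rewrite /u2 -EFinM lee_fin mulr_ge0.
have u2nd z : {homo (fun k => u2 k z) : a b / (a <= b)%N >-> (a <= b)%E}.
  move=> a b ab; rewrite /u2 -!EFinM lee_fin ler_wpM2l// ler_wpM2l ?indicE ?ler0n//.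
  by rewrite le_min !ge_min lexx orbT ler_nat ab.
have cvu : (\int[(Q \x D)%E]_z u2 k z)%E @[k --> \oo] -->
    (\int[(Q \x D)%E]_z (fun z => limn (u2^~ z)) z)%E.
  by apply: cvg_monotone_convergence => // z _; exact: u2nd.
have limu : (fun z => limn (u2^~ z)) = (fun z => (nn z * pay z)%:E).
  (* Once [k] exceeds half of the payment, the cap is inactive and the sequence is constant. *)
  apply/funext => z; apply/cvg_lim => //; apply: cvg_near_cst; near=> k.
  rewrite /u2 /u -EFinM (min_idPr _); first by congr EFin; field.
  by near: k; exact: nbhs_infty_ger.
have -> : (\int[(Q \x D)%E]_z (p z.1 (sel z.1 z.2))%:E
    = \int[(Q \x D)%E]_z (fun z => limn (u2^~ z)) z)%E.
  rewrite limu; apply: ae_eq_integral => //.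
  - exact/measurable_EFinP.
  - by apply/measurable_EFinP; apply: measurable_funM.
  by apply: ae_eq_nonneg_val => // z v0; rewrite nnE// mul1r.
rewrite -(cvg_lim _ cvu)//; apply: lime_le.
  by apply/cvg_ex; eexists; exact: cvu.
apply: nearW => k.
rewrite ge0_integralZl//; [|exact/measurable_EFinP|by move=> z _; rewrite lee_fin].
  apply: (@le_trans _ _ (2%:E * (\sum_(j < m) \int[(Q \x D)%E]_z
      truncated_gain p sel T k%:R j z)%:E)%E).
    apply: lee_wpmul2l => //.
    exact: (le_sum_truncated_gain D Q pB best mp ms (ler0n R k) mT).
  rewrite -EFinM; apply: ereal_sup_ubound; eexists; last by [].
  eexists; split; last by [].
    by move=> j; apply: truncated_gain_Rintegral_ge0.
  exact: (single_buyer_guarantee D0 pB best mp ms sel_le (ler0n R k) T0).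
Unshelve. all: by end_near.
Qed.

(** Each buyer gets one certificate, and the certificates are composed. The factor [4 * T] consists
    of 2 from the certificates and [2 * T] from the composition. *)
Lemma ExAnte_BuyManyRev_le (R : realType) (n m : nat)
    (D : 'I_n -> probability (valuation R m) R) (T : nat) :
  (forall i, D i (@nonneg_val R m) = 1%E) ->
  (1 < T)%N -> m%:R * 2^-1 ^+ T <= 2^-1 :> R ->
  (ExAnte_BuyManyRev D <= (4 * T%:R)%:E * SRev D)%E.
Proof.
move=> D0 T2 mT; apply: ge_ereal_sup => _ [x [x0 x1 ->]].
apply: (@le_trans _ _ (\sum_(i < n)
    ereal_sup (EFin @` guaranteed_revenues (D i) (x i) T))%E).
  by apply: lee_sum => i _; apply: BuyManyRev_le_sup => //; exact: ltnW.
apply: sum_ereal_sup_le => [|i|r Sr]; first exact: index_enum_uniq.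
  exact: guaranteed_revenues_neq0.
pose G i := projT1 (cid (Sr i)).
have GP i : [/\ forall j, 0 <= G i j, profit_guarantee (D i) (x i) T (G i)
    & r i = 2 * \sum_(j < m) G i j] by exact: projT2 (cid (Sr i)).
have -> : \sum_(i < n) r i = 2 * \sum_(i < n) \sum_(j < m) G i j.
  by rewrite mulr_sumr; apply: eq_bigr => i _; case: (GP i).
have := @sequential_revenue_ge_half R m n D x G T (fun i => let: And3 _ g _ := GP i in g)
  T2 x0 x1 (fun i => let: And3 g _ _ := GP i in g).
move=> /(@lee_wpmul2l R 2%:E)-/(_ _); rewrite -EFinM muleA -EFinM mulrA.
by rewrite (_ : 2 * 2 = 4 :> R); [apply; rewrite lee_fin|rewrite -natrM].
Qed.

Theorem theorem1 : exists C : nat,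
  forall (R : realType) (n m : nat) (D : 'I_n -> probability (valuation R m) R),
    (forall i, D i (nonneg_val (R := R) (m := m)) = 1%E) ->
    (ExAnte_BuyManyRev D <= ((C%:R * (ln (m%:R : R) + 1))%:E * SRev D))%E.
Proof.
(* The constant is 4 from [ExAnte_BuyManyRev_le] times 2 from the bound of [T] by the logarithm. *)
exists 8 => R n m D D0.
(* One increment brings the power of two above [m], the other doubles it; together they ensure
   [T >= 2] even for [m <= 1]. *)
pose T := (trunc_log 2 m).+2.
have mT : (m * 2 <= 2 ^ T)%N.
  rewrite /T expnS mulnC leq_mul2l/= ltnW//.
  exact: trunc_log_ltn.
have mTR : m%:R * 2^-1 ^+ T <= 2^-1 :> R.
  rewrite exprVn -[leRHS]mul1r ler_pdivrMr ?exprn_gt0// mulrAC.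
  rewrite ler_pdivlMr// mul1r -natrX -natrM ler_nat//.
have TL : T%:R <= 2 * (ln (m%:R : R) + 1).
  have ln2 : 2^-1 <= ln (2 : R).
    (* The inequality [ln (1 + x) <= x] at [x = - 1/2] bounds [ln 2] from below by one half. *)
    have := @le_ln1Dx R (- 2^-1); rewrite (_ : 1 + - 2^-1 = 2^-1 :> R); last by field.
    by rewrite lnV ?posrE//; move=> /(_ ltac:(lra)); lra.
  have logm : (trunc_log 2 m)%:R * 2^-1 <= ln (m%:R : R).
    (* For [m = 0] both logarithms take the default value zero. *)
    have [->|m0] := posnP m; first by rewrite trunc_log0 mul0r ln0.
    apply: (@le_trans _ _ ((trunc_log 2 m)%:R * ln 2)); first by rewrite ler_wpM2l.
    rewrite mulr_natl -lnXn// -natrX ler_ln ?posrE ?ltr0n ?expn_gt0// ler_nat.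
    exact: trunc_logP.
  by rewrite /T -addn2 natrD; lra.
apply: (le_trans (ExAnte_BuyManyRev_le D0 _ mTR)) => //.
(* Zero prices show that [SRev] is nonnegative, so its factor may be enlarged. *)
have S0 : (0 <= SRev D)%E.
  apply: le_ereal_sup_tmp; exists (seq_rev D (fun _ _ => 0) (enum 'I_n) [set: 'I_m]%SET).
    by exists (enum 'I_n), (fun _ _ => 0).
  by rewrite seq_revE lee_fin real_seq_rev_ge0.
apply: lee_wpmul2r => //; rewrite lee_fin; lra.
Qed.
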